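(* Let $n\ge 1$, $\lambda>0$ and $\sigma_1\ge\dots\ge\sigma_{n-1}\ge 1$, and let $\nu$ be the Lorentzian inner product $\operatorname{diag}\{\sigma_1,\sigma_1,\dots,\sigma_{n-1},\sigma_{n-1},1,-1,\lambda\}$ on the Heisenberg Lie algebra $\mathfrak{h}_{2n+1}$ in the basis $\{f_1,g_1,\dots,f_n,g_n,z\}$. Then $\nu$ is an algebraic Ricci soliton only for $n=1$ (that is, $\nu$ is an algebraic Ricci soliton if and only if $n=1$). In the case $n=1$, $\nu=\operatorname{diag}\{1,-1,\lambda\}$ and its algebraic Ricci soliton equation, with respect to the orthonormal basis $\{v_1=f_1,\ v_2=\frac{1}{\sqrt{\lambda}}z,\ v_3=g_1\}$, is $$\operatorname{Ric}=\operatorname{diag}\left\{\frac{\lambda}{2},\frac{-\lambda}{2},\frac{\lambda}{2}\right\}=\frac{3\lambda}{2}I_3+\operatorname{diag}\{-\lambda,-2\lambda,-\lambda\},$$ where $D=\operatorname{diag}\{-\lambda,-2\lambda,-\lambda\}$ is (with respect to this basis) a derivation of $\mathfrak{h}_3$.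
   Context: The Heisenberg Lie algebra $\mathfrak{h}_{2n+1}$ is the real Lie algebra with basis $\{f_1,g_1,\dots,f_n,g_n,z\}$ whose only nonzero brackets of basis elements (up to antisymmetry) are $[f_i,g_i]=z$, $i=1,\dots,n$. For $n=1$ there are no $\sigma_k$. A Lorentzian inner product is a nondegenerate symmetric bilinear form of signature $(2n,1)$; an orthonormal basis $\{v_1,\dots,v_m\}$ satisfies $\langle v_i,v_j\rangle=0$ for $i\ne j$, $\langle v_i,v_i\rangle=1$ for $i<m$, and $\langle v_m,v_m\rangle=-1$. The Levi-Civita connection of $(\mathfrak{g},\langle\cdot,\cdot\rangle)$ is the bilinear map $(u,v)\mapsto\nabla_uv$ on $\mathfrak{g}$ determined by the Koszul formula $2\langle\nabla_uv,w\rangle=\langle[u,v],w\rangle+\langle[w,u],v\rangle+\langle[w,v],u\rangle$. The curvature is $R_{uv}w=\nabla_{[u,v]}w-\nabla_u\nabla_vw+\nabla_v\nabla_uw$, and the Ricci operator is $\operatorname{Ric}(u)=\sum_{k=1}^{m}\langle v_k,v_k\rangle R_{v_ku}v_k$ for an orthonormal basis $\{v_1,\dots,v_m\}$. A Lorentzian inner product on a Lie algebra $\mathfrak{g}$ is an algebraic Ricci soliton if $\operatorname{Ric}=\eta\operatorname{Id}_{\mathfrak{g}}+D$ for some $\eta\in\mathbb{R}$ and some derivation $D$ of $\mathfrak{g}$, i.e. a linear map with $[D(u),v]+[u,D(v)]=D[u,v]$ for all $u,v\in\mathfrak{g}$. *)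

(* Defs.v *)
From HB Require Import structures.
From mathcomp Require Import all_boot all_order all_algebra.
From mathcomp Require Import perm sesquilinear reals.

Set Implicit Arguments.
Unset Strict Implicit.
Unset Printing Implicit Defensive.

Import Order.TTheory GRing.Theory Num.Theory.
Local Open Scope ring_scope.

Section LieAlgebra.
Variables (R : realType) (V : vectType R).

Record lie_bracket := LieBracket {
  bracket :> {bilinear V -> V -> V};
  bracket_alternating : forall u, bracket u u = 0;
  bracket_jacobi : forall u v w,
    bracket u (bracket v w) + bracket v (bracket w u) + bracket w (bracket u v)
      = 0 }.

Definition derivation (br : lie_bracket) (D : 'End(V)) : Prop :=
  forall u v, br (D u) v + br u (D v) = D (br u v).

(* The last vector of the basis is the timelike one. *)
Definition orthonormal_basis (b : {symmetric V}) m (v : m.+1.-tuple V) : Prop :=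
  basis_of fullv v /\
  forall i j : 'I_m.+1, b (tnth v i) (tnth v j) =
    if i != j then 0 else if i == ord_max then -1 else 1.

(* Signature (m, 1) on a space of dimension m + 1; nondegeneracy follows. *)
Definition lorentzian (b : {symmetric V}) : Prop :=
  exists m (v : m.+1.-tuple V), orthonormal_basis b v.

(* Only meaningful for a nondegenerate b, when the Koszul formula has exactly
   one solution nabla. *)
Definition levi_civita (br : lie_bracket) (b : {symmetric V})
    (nabla : {bilinear V -> V -> V}) : Prop :=
  forall u v w,
    2 * b (nabla u v) w = b (br u v) w + b (br w u) v + b (br w v) u.

Definition curvature (br : lie_bracket) (nabla : {bilinear V -> V -> V})
    (u v w : V) : V :=
  nabla (br u v) w - nabla u (nabla v w) + nabla v (nabla u w).

(* The sum below does not depend on the choice of the orthonormal basis. *)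
Definition ricci_operator (br : lie_bracket) (b : {symmetric V})
    (Ric : 'End(V)) : Prop :=
  exists nabla, levi_civita br b nabla /\
  exists m (v : m.+1.-tuple V), orthonormal_basis b v /\
  forall u, Ric u = \sum_(k < m.+1)
    b (tnth v k) (tnth v k) *: curvature br nabla (tnth v k) u (tnth v k).

Definition algebraic_ricci_soliton (br : lie_bracket) (b : {symmetric V}) :
    Prop :=
  lorentzian b /\
  exists Ric, ricci_operator br b Ric /\
  exists (eta : R) (D : 'End(V)),
    derivation br D /\ Ric = eta *: \1%VF + D.

Section DiagOperator.
Variables (m : nat) (v : m.-tuple V) (d : m.-tuple R).

Definition diag_operator_fun (u : V) : V :=
  \sum_(k < m) (tnth d k * coord v k u) *: tnth v k.

Lemma diag_operator_linear : linear diag_operator_fun.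
Proof.
move=> a x y; rewrite /diag_operator_fun scaler_sumr -big_split /=.
by apply: eq_bigr => k _; rewrite linearP mulrDr scalerDl scalerA mulrCA.
Qed.

HB.instance Definition _ := GRing.isSemilinear.Build R _ _ _ diag_operator_fun
  (GRing.semilinear_linear diag_operator_linear).

(* The operator with matrix diag d with respect to the basis v. *)
Definition diag_operator : 'End(V) := linfun diag_operator_fun.

Lemma diag_operatorE k : free v ->
  diag_operator (tnth v k) = tnth d k *: tnth v k.
Proof.
move=> fv; rewrite lfunE /= /diag_operator_fun (bigD1 k) //= big1 => [|j ne_jk].
  by rewrite addr0 (tnth_nth 0 v) coord_free // eqxx mulr1.
by rewrite (tnth_nth 0 v k) coord_free // eq_sym (negPf ne_jk) mulr0 scale0r.
Qed.

End DiagOperator.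

End LieAlgebra.

Section DiagForm.
Variables (R : realType) (m : nat).

Definition diag_form_fun (d : seq R) (u v : 'rV[R]_m) : R :=
  \sum_(k < m) d`_k * u 0 k * v 0 k.

Lemma diag_form_bilinear d :
  bilinear_for (GRing.Scale.Law.clone _ _ *%R _)
    (GRing.Scale.Law.clone _ _ (idfun \; *%R) _) (diag_form_fun d).
Proof.
split=> w a u v; rewrite /= /diag_form_fun mulr_sumr -big_split /=;
  apply: eq_bigr => k _; rewrite !mxE.
- by rewrite mulrDr mulrDl mulrCA !mulrA.
- by rewrite mulrDr mulrCA !mulrA.
Qed.

HB.instance Definition _ d := bilinear_isBilinear.Build R _ _ _ _ _
  (diag_form_fun d) (diag_form_bilinear d).

Lemma diag_form_sym d u v :
  diag_form_fun d u v = (-1) ^+ false * idfun (diag_form_fun d v u).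
Proof.
by rewrite mul1r; apply: eq_bigr => k _; rewrite mulrAC.
Qed.

HB.instance Definition _ d := isHermitianSesquilinear.Build R _ _ _
  (diag_form_fun d) (diag_form_sym d).

Definition diag_form (d : seq R) : {symmetric 'rV[R]_m} := diag_form_fun d.

Lemma diag_form_delta d i j :
  diag_form d (delta_mx 0 i) (delta_mx 0 j) = if i != j then 0 else d`_i.
Proof.
rewrite /= /diag_form_fun (bigD1 i) //= big1 => [|k ne_ki].
  rewrite !mxE !eqxx /= addr0 mulr1.
  by case: eqVneq => _; rewrite /= ?mulr1 ?mulr0.
by rewrite !mxE (negPf ne_ki) /= mulr0 mul0r.
Qed.

End DiagForm.

Lemma diag_form_lorentzian (R : realType) m (d : seq R) (k : 'I_m.+1) :
  d`_k < 0 -> (forall i : 'I_m.+1, i != k -> 0 < d`_i) ->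
  lorentzian (diag_form m.+1 d).
Proof.
move=> dk_lt0 d_gt0.
have d_neq0 i : 0 < `|d`_(i : 'I_m.+1)|.
  by rewrite normr_gt0; case: (eqVneq i k) => [->|/d_gt0/gt_eqF->//]; rewrite lt_eqF.
pose p := tperm k ord_max; pose w (i : 'I_m.+1) : 'rV[R]_m.+1 :=
  (Num.sqrt `|d`_(p i)|)^-1 *: delta_mx 0 (p i).
have wE i j : diag_form m.+1 d (w i) (w j) =
    if i != j then 0 else if i == ord_max then -1 else 1.
  rewrite linearZl linearZr /= diag_form_delta (inj_eq perm_inj).
  case: eqVneq => [<-|_] /=; last by rewrite !mulr0.
  rewrite mulrA -invfM -expr2 sqr_sqrtr //.
  have -> : (i == ord_max) = (p i == k).
    by rewrite -[in RHS](tpermR k ord_max) (inj_eq perm_inj).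
  case: eqVneq => [->|/d_gt0 di_gt0].
    by rewrite ltr0_norm // invrN mulNr mulVf ?lt_eqF.
  by rewrite gtr0_norm // mulVf ?gt_eqF.
have [t tE] : exists t : m.+1.-tuple 'rV[R]_m.+1, tnth t =1 w.
  by exists (mktuple w) => i; rewrite tnth_mktuple.
exists m, t; split; last by move=> i j; rewrite !tE.
rewrite basisEfree subvf size_tuple dimvf /dim /= mul1n leqnn !andbT.
apply/freeP => c c0 i.
have := congr1 (diag_form m.+1 d ^~ (w i)) c0; rewrite linear_sumlz linear0l.
rewrite (bigD1 i) //= big1 => [|j ne_ji]; rewrite -tnth_nth tE linearZl /= wE.
  rewrite eqxx addr0 /=; case: ifP => _; first by rewrite mulrN1 => /eqP; rewrite oppr_eq0 => /eqP.
  by rewrite mulr1.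
by rewrite ne_ji mulr0.
Qed.

(* The basis f_1, g_1, ..., f_n, g_n, z is the canonical basis of R^(2n+1), in
   this order; f i and g i are f_(i+1) and g_(i+1), meaningful for i < n only. *)
Section Heisenberg.
Variables (R : realType) (n : nat).
Local Notation V := 'rV[R]_(n.*2.+1).

Definition heis_f (i : nat) : V := delta_mx 0 (inord i.*2).
Definition heis_g (i : nat) : V := delta_mx 0 (inord i.*2.+1).
Definition heis_z : V := delta_mx 0 ord_max.

Definition heis_bracket_fun (u v : V) : V :=
  (\sum_(i < n) (u 0 (inord i.*2) * v 0 (inord i.*2.+1)
               - u 0 (inord i.*2.+1) * v 0 (inord i.*2))) *: heis_z.

Lemma heis_bracket_bilinear :
  bilinear_for (GRing.Scale.Law.clone _ _ *:%R _)
    (GRing.Scale.Law.clone _ _ *:%R _) heis_bracket_fun.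
Proof.
split=> w a u v; rewrite /= /heis_bracket_fun scalerA -scalerDl mulr_sumr;
  congr (_ *: _); rewrite -big_split /=; apply: eq_bigr => i _; rewrite !mxE.
- by rewrite !mulrDl mulrBr !mulrA opprD addrACA.
- by rewrite !mulrDr mulrN !(mulrCA a) opprD addrACA.
Qed.

HB.instance Definition _ := bilinear_isBilinear.Build R _ _ _ _ _
  heis_bracket_fun heis_bracket_bilinear.

Lemma heis_bracket_alternating u : heis_bracket_fun u u = 0.
Proof.
rewrite /heis_bracket_fun big1 ?scale0r // => i _.
by rewrite [X in _ - X]mulrC subrr.
Qed.

Let inord_eq k l : (k <= n.*2)%N -> (l <= n.*2)%N ->
  (inord k == inord l :> 'I_n.*2.+1) = (k == l).
Proof. by move=> lek lel; rewrite -val_eqE /= !inordK. Qed.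

Let ltS_double i : (i < n)%N -> (i.*2.+1 < n.*2)%N.
Proof. by move=> lt_in; rewrite -doubleS leq_double. Qed.

Lemma heis_z_central u : heis_bracket_fun u heis_z = 0.
Proof.
rewrite /heis_bracket_fun big1 ?scale0r // => i _.
have lt_i := ltS_double (ltn_ord i).
rewrite !mxE -[ord_max]inord_val !inord_eq ?(ltnW lt_i) ?(ltnW (ltnW lt_i)) //=.
by rewrite (ltn_eqF lt_i) (ltn_eqF (ltnW lt_i)) !mulr0 subrr.
Qed.

Lemma heis_bracket_jacobi u v w :
  heis_bracket_fun u (heis_bracket_fun v w)
  + heis_bracket_fun v (heis_bracket_fun w u)
  + heis_bracket_fun w (heis_bracket_fun u v) = 0.
Proof.
have H x y t : heis_bracket_fun x (heis_bracket_fun y t) = 0.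
  rewrite [heis_bracket_fun y t]/heis_bracket_fun linearZr_LR /=.
  by rewrite heis_z_central scaler0.
by rewrite !H !addr0.
Qed.

Definition heisenberg : lie_bracket V :=
  LieBracket heis_bracket_alternating heis_bracket_jacobi.

Lemma heisenberg_ff i j : (i < n)%N -> (j < n)%N ->
  heisenberg (heis_f i) (heis_f j) = 0.
Proof.
move=> /ltS_double/ltnW lt_i /ltS_double/ltnW lt_j.
rewrite /= /heis_bracket_fun big1 ?scale0r // => k _.
have lt_k := ltS_double (ltn_ord k).
rewrite !mxE !inord_eq ?(ltnW lt_k) ?(ltnW lt_i) ?(ltnW lt_j) ?(ltnW (ltnW lt_k)) //=.
have odd_neq a b : (a.*2.+1 == b.*2) = false.
  by apply/eqP => /(congr1 odd); rewrite /= !odd_double.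
by rewrite !odd_neq mulr0 mul0r subrr.
Qed.

Lemma heisenberg_gg i j : (i < n)%N -> (j < n)%N ->
  heisenberg (heis_g i) (heis_g j) = 0.
Proof.
move=> /ltS_double/ltnW lt_i /ltS_double/ltnW lt_j.
rewrite /= /heis_bracket_fun big1 ?scale0r // => k _.
have lt_k := ltS_double (ltn_ord k).
rewrite !mxE !inord_eq ?(ltnW lt_k) ?(ltnW (ltnW lt_k)) //=.
have odd_neq a b : (a.*2 == b.*2.+1) = false.
  by apply/eqP => /(congr1 odd); rewrite /= !odd_double.
by rewrite !odd_neq mulr0 mul0r subrr.
Qed.

Lemma heisenberg_fg i j : (i < n)%N -> (j < n)%N ->
  heisenberg (heis_f i) (heis_g j) = (i == j)%:R *: heis_z.
Proof.
move=> lt_i lt_j; have/ltnW le_i := ltS_double lt_i.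
have/ltnW le_j := ltS_double lt_j.
congr (_ *: _); rewrite (bigD1 (Ordinal lt_i)) //= big1 => [|k ne_ki].
  rewrite !mxE !inord_eq ?(ltnW le_i) ?(ltnW le_j) //= eqxx eqSS.
  have -> : (i.*2.+1 == i.*2) = false by rewrite gtn_eqF.
  by rewrite (inj_eq double_inj) mul0r subr0 addr0 mul1r.
have lt_k := ltS_double (ltn_ord k).
rewrite !mxE !inord_eq ?(ltnW lt_k) ?(ltnW (ltnW lt_k)) ?(ltnW le_i) //=.
rewrite -val_eqE /= in ne_ki; rewrite (inj_eq double_inj) (negPf ne_ki) mul0r.
have -> : (k.*2.+1 == i.*2) = false.
  by apply/eqP => /(congr1 odd); rewrite /= !odd_double.
by rewrite mul0r subrr.
Qed.

Definition heis_form (sigma : n.-1.-tuple R) (lambda : R) : {symmetric V} :=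
  diag_form _ (flatten [seq [:: s; s] | s <- sigma] ++ [:: 1; -1; lambda]).

Lemma heis_form_lorentzian sigma lambda : (0 < n)%N -> 0 < lambda ->
  {in sigma, forall s, 1 <= s} -> lorentzian (heis_form sigma lambda).
Proof.
move=> n_gt0 lambda_gt0 sigma_ge1.
set d := flatten [seq [:: s; s] | s <- sigma].
have size_d : size d = n.-1.*2.
  rewrite size_flatten /shape -map_comp -[in RHS](size_tuple sigma).
  by elim: (tval sigma) => //= _ s ->; rewrite doubleS.
have nE : n.*2 = n.-1.*2.+2 by rewrite -doubleS prednK.
have lt_k : (n.-1.*2.+1 < n.*2.+1)%N by rewrite nE.
apply: (@diag_form_lorentzian _ _ _ (Ordinal lt_k)) => [|i].
  by rewrite /= -/d nth_cat size_d ltnNge leqnSn /= subSnn /= oppr_lt0.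
rewrite -val_eqE /= -/d nth_cat size_d; case: ltnP => [lt_i _|le_i ne_i].
  have /flatten_mapP[s s_sigma] : d`_i \in d by rewrite mem_nth ?size_d.
  by rewrite !inE orbb => /eqP->; rewrite (lt_le_trans ltr01) ?sigma_ge1.
have lt_i : (i < n.-1.*2.+3)%N by rewrite -nE.
move: (nat_of_ord i) le_i ne_i lt_i => {i} j /subnKC <-.
rewrite addKn -addn3 ltn_add2l -addn1 eqn_add2l.
by case: (j - _)%N => [|[|[|]]].
Qed.

End Heisenberg.

(* Main.v *)
From HB Require Import structures.
Require Import Defs.
From mathcomp Require Import all_boot all_order all_algebra.
From mathcomp Require Import sesquilinear reals ring lra.

Set Implicit Arguments.
Unset Strict Implicit.
Unset Printing Implicit Defensive.

Import Order.TTheory GRing.Theory Num.Theory.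
Local Open Scope ring_scope.

(** The argument computes the Ricci operator once, for every metric Lie algebra
    whose bracket has the form [u, v] = <J u, v> z, with J a skew operator
    killing z.  There the Levi-Civita connection is
      nabla_u v = 1/2 (<J u, v> z - <z, v> J u - <z, u> J v),
    and contracting its curvature over an orthonormal basis gives
      Ric u = <z, z>/2 J^2 u - tr(J^2)/4 <z, u> z
    ([ricci_centralP]).  The trace is taken with respect to the metric, hence
    is the same for all orthonormal bases ([metric_trace_indep]).

    For the Heisenberg algebra with a diagonal metric, J maps f_i to a multiple
    of g_i and g_i to a multiple of f_i, so that J^2 acts on the plane of f_i
    and g_i as the scalar - 1 / (<f_i, f_i> <g_i, g_i>), and Ric acts there as a
    scalar p_i.  If Ric - eta is a derivation, applying it to [f_i, g_i] = z
    shows that 2 (p_i - eta) is its eigenvalue on z, the same for all i.  So an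
    algebraic Ricci soliton has the same product <f_i, f_i> <g_i, g_i> on all
    planes ([heis_soliton_pairs]).  For the metric at hand this product is
    negative on the last plane and positive on all others, which leaves only
    n = 1.  In that case J^2 is the identity on the plane of f_1 and g_1, its
    trace is 2, and the formula gives the eigenvalues lambda/2, -lambda/2 and
    lambda/2 of Ric; subtracting 3 lambda/2 leaves an operator that scales f_1
    and g_1 by -lambda and z by -2 lambda, which is a derivation. *)

(** * Orthonormal bases *)

Section Orthonormal.
Variables (R : realType) (V : vectType R) (b : {symmetric V}).

Lemma form_sym u v : b u v = b v u.
Proof. by rewrite hermC /= expr0 mul1r. Qed.

Variables (m : nat) (v : m.+1.-tuple V).
Hypothesis v_on : orthonormal_basis b v.

Local Notation eps k := (b (tnth v k) (tnth v k)).

Lemma orthonormal_expansion u :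
  \sum_(k < m.+1) (eps k * b (tnth v k) u) *: tnth v k = u.
Proof.
have [v_basis v_orth] := v_on.
rewrite [RHS](coord_basis v_basis (memvf u)); apply: eq_bigr => k _.
rewrite -tnth_nth; congr (_ *: _).
rewrite {1}(coord_basis v_basis (memvf u)) linear_sumr (bigD1 k) //=.
rewrite big1 => [|j ne_jk]; rewrite -tnth_nth linearZr /= !v_orth.
  rewrite eqxx addr0.
  by case: ifP => _; rewrite ?mulr1 ?mulrN1 ?mulN1r ?opprK ?mul1r.
by rewrite eq_sym ne_jk mulr0.
Qed.

Lemma orthonormal_nondegenerate x y : (forall w, b x w = b y w) -> x = y.
Proof.
move=> xy; rewrite -[x]orthonormal_expansion -[y]orthonormal_expansion.
by apply: eq_bigr => k _; rewrite ![b _ x]form_sym ![b _ y]form_sym xy.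
Qed.

(** Contracting an orthonormal basis against a vector: this evaluates the terms
    of the Ricci sum in which a basis vector occurs once in the metric and once
    in a vector-valued argument. *)
Lemma orthonormal_contraction (W : lmodType R) (L : {linear V -> W}) y :
  \sum_(k < m.+1) (eps k * b y (tnth v k)) *: L (tnth v k) = L y.
Proof.
rewrite -{2}[y]orthonormal_expansion linear_sum; apply: eq_bigr => k _.
by rewrite linearZ form_sym.
Qed.

Lemma orthonormal_parseval x y :
  \sum_(k < m.+1) eps k * (b x (tnth v k) * b y (tnth v k)) = b x y.
Proof.
rewrite -{2}[y]orthonormal_expansion linear_sumr; apply: eq_bigr => k _.
by rewrite linearZ /= [b y _]form_sym; ring.
Qed.

Definition metric_trace (A : 'End(V)) : R :=
  \sum_(k < m.+1) eps k * b (A (tnth v k)) (tnth v k).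

End Orthonormal.

Lemma orthonormal_lfun_ext (R : realType) (V : vectType R) (b : {symmetric V})
    m (v : m.+1.-tuple V) (T : 'End(V)) (F : {linear V -> V}) :
  orthonormal_basis b v ->
  (forall k, T (tnth v k) = F (tnth v k)) -> T =1 F.
Proof.
move=> v_on TF u; rewrite -[u](orthonormal_expansion v_on) !linear_sum.
by apply: eq_bigr => k _; rewrite !linearZ /= TF.
Qed.

(** Pairing a vanishing linear combination with each vector kills its
    coefficients, so only the dimension has to be known besides the Gram
    matrix. *)
Lemma orthonormal_basis_of_gram (R : realType) (V : vectType R)
    (b : {symmetric V}) m (v : m.+1.-tuple V) : \dim {:V} = m.+1 ->
  (forall i j : 'I_m.+1, b (tnth v i) (tnth v j) =
    if i != j then 0 else if i == ord_max then -1 else 1) ->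
  orthonormal_basis b v.
Proof.
move=> dimV v_gram; split=> //.
rewrite basisEfree subvf size_tuple dimV leqnn !andbT.
apply/freeP => c c0 i.
have := congr1 (b ^~ (tnth v i)) c0; rewrite linear_sumlz linear0l.
rewrite (bigD1 i) //= big1 => [|j ne_ji]; rewrite -tnth_nth linearZl /= v_gram.
  rewrite eqxx addr0 /=; case: ifP => _; last by rewrite mulr1.
  by rewrite mulrN1 => /eqP; rewrite oppr_eq0 => /eqP.
by rewrite ne_ji mulr0.
Qed.

(** Expanding the vectors of either basis in the other one turns both traces
    into the same double sum. *)
Lemma metric_trace_indep (R : realType) (V : vectType R) (b : {symmetric V})
    m (v : m.+1.-tuple V) p (w : p.+1.-tuple V) (A : 'End(V)) :
  orthonormal_basis b v -> orthonormal_basis b w ->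
  metric_trace b v A = metric_trace b w A.
Proof.
move=> v_on w_on; rewrite /metric_trace.
transitivity (\sum_(k < m.+1) \sum_(l < p.+1)
   (b (tnth v k) (tnth v k) * b (tnth w l) (tnth v k)) *
   (b (tnth w l) (tnth w l) * b (A (tnth w l)) (tnth v k))).
  apply: eq_bigr => k _; rewrite -{3}[tnth v k](orthonormal_expansion w_on).
  rewrite !linear_sum linear_sumlz mulr_sumr; apply: eq_bigr => l _.
  by rewrite linearZ linearZl /=; ring.
rewrite exchange_big; apply: eq_bigr => l _ /=.
rewrite -{8}[tnth w l](orthonormal_expansion v_on) linear_sumr mulr_sumr.
apply: eq_bigr => k _; rewrite linearZr /= [b (tnth v k) (tnth w l)]form_sym.
by ring.
Qed.

(** The Koszul formula prescribes all scalar products of nabla_u v, and a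
    Lorentzian form is nondegenerate. *)
Lemma levi_civita_unique (R : realType) (V : vectType R)
    (br : lie_bracket V) (b : {symmetric V}) (N N' : {bilinear V -> V -> V}) :
  lorentzian b -> levi_civita br b N -> levi_civita br b N' -> N =2 N'.
Proof.
move=> [m [v v_on]] NP N'P x y; apply: (orthonormal_nondegenerate v_on) => w.
by apply: (@mulfI _ 2); rewrite ?pnatr_eq0 // NP N'P.
Qed.

(** Reduces an identity in a vector space to identities between scalars, which
    can be decided by ring normalization. *)
Lemma coord_ext (R : realType) (V : vectType R) (x y : V) :
  (forall i, coord (vbasis fullv) i x = coord (vbasis fullv) i y) -> x = y.
Proof.
move=> xy; rewrite (coord_vbasis (memvf x)) (coord_vbasis (memvf y)).
by apply: eq_bigr => i _; rewrite xy.
Qed.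

Lemma lie_anticomm (R : realType) (V : vectType R) (br : lie_bracket V) u v :
  br u v = - br v u.
Proof.
have := bracket_alternating br (u + v).
rewrite linearDl /= !linearDr /= !bracket_alternating add0r addr0.
by rewrite addrC => /eqP; rewrite addr_eq0 => /eqP ->; rewrite opprK.
Qed.

(** * Metric Lie algebras whose brackets span a central line *)

Section CentralBracket.
Variables (R : realType) (V : vectType R) (br : lie_bracket V).
Variables (b : {symmetric V}) (J : 'End(V)) (z : V).
Hypothesis brE : forall u v, br u v = b (J u) v *: z.
Hypothesis Jz : J z = 0.
Hypothesis J_skew : forall u v, b (J u) v = - b u (J v).

(** The solution of the Koszul formula: there <[w, u], v> = <J w, u> <z, v>, which
    by skewness of J is - <z, v> <J u, w>, and likewise with u and v exchanged. *)
Definition central_connection (u v : V) : V :=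
  2^-1 *: (b (J u) v *: z - b z v *: J u - b z u *: J v).

Lemma central_connection_bilinear :
  bilinear_for (GRing.Scale.Law.clone _ _ *:%R _)
    (GRing.Scale.Law.clone _ _ *:%R _) central_connection.
Proof.
by split=> w a u v; apply: coord_ext => i;
  rewrite /= /central_connection !linearP /= ?linearPl /=;
  rewrite !linearD !linearN !linearZ /=; ring.
Qed.

HB.instance Definition _ := bilinear_isBilinear.Build R _ _ _ _ _
  central_connection central_connection_bilinear.

Lemma levi_civita_central : levi_civita br b central_connection.
Proof.
move=> u v w; rewrite /= /central_connection !brE !linearZl /= !linearBl /=.
by rewrite !linearZl /= !(J_skew w) ![b w _]form_sym; field.
Qed.

(** Only the curvatures that enter the Ricci sum.  The terms are arranged so that
    each of them is quadratic in v in a form that can be contracted. *)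
Lemma curvature_central u v : curvature br central_connection v u v =
  (3 / 4 * b z z * b (J u) v) *: J v
  + (4^-1 * (b z v * b (J (J u)) v)) *: z
  - (4^-1 * (b z v * b z v)) *: J (J u)
  - (4^-1 * b z u * b (J (J v)) v) *: z
  + (4^-1 * b z u * b z v) *: J (J v).
Proof.
have zJ w : b z (J w) = 0 by rewrite -[b z _]opprK -J_skew Jz linear0l oppr0.
have JJ w t : b (J w) (J t) = - b (J (J w)) t by rewrite -[LHS]opprK -J_skew.
have Jww w : b (J w) w = 0.
  have := J_skew w w; rewrite [b w _]form_sym => /eqP.
  by rewrite -addr_eq0 -mulr2n mulrn_eq0 /= => /eqP.
have Jvu : b (J v) u = - b (J u) v by rewrite J_skew form_sym.
have JJvu : b (J (J v)) u = b (J (J u)) v.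
  by rewrite J_skew J_skew opprK form_sym.
have Nz w : central_connection z w = (- (b z z / 2)) *: J w.
  rewrite /central_connection Jz linear0l scale0r scaler0 subr0 sub0r.
  by rewrite scalerN scaleNr scalerA mulrC.
have Nz' w : central_connection w z = (- (b z z / 2)) *: J w.
  rewrite /central_connection Jz [b _ z]form_sym zJ scale0r scaler0 subr0 sub0r.
  by rewrite scalerN scaleNr scalerA mulrC.
have NJ w t : central_connection w (J t) =
    (- (b (J (J w)) t / 2)) *: z - (b z w / 2) *: J (J t).
  rewrite /central_connection zJ scale0r subr0 JJ scalerBr !scalerA.
  by rewrite mulrN ![2^-1 * _]mulrC.
have Nww w : central_connection w w = (- b z w) *: J w.
  rewrite /central_connection Jww scale0r sub0r -opprD -mulr2n -scaler_nat.
  by rewrite scalerN !scalerA mulVf ?pnatr_eq0 // mul1r scaleNr.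
have Nuv : central_connection v (central_connection u v) =
    2^-1 *: (b (J u) v *: central_connection v z
      - b z v *: central_connection v (J u)
      - b z u *: central_connection v (J v)).
  by rewrite {2}/central_connection linearZr linearBr linearBr !linearZr.
rewrite /curvature brE linearZl /= Nz Nww Nuv linearZr /= Nz' !NJ Jvu JJvu.
apply: coord_ext => i; rewrite !linearD !linearN !linearZ /=.
by field.
Qed.

(** The Ricci operator, with t standing for the trace of J^2. *)
Definition central_ricci (t : R) (u : V) : V :=
  (b z z / 2) *: J (J u) - (t / 4 * b z u) *: z.

Lemma central_ricci_linear t : linear (central_ricci t).
Proof.
move=> a u v; apply: coord_ext => i; rewrite /central_ricci !linearP /=.
by rewrite !(linearD, linearN, linearZ) /=; ring.
Qed.

HB.instance Definition _ t := GRing.isLinear.Build R V V _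
  (central_ricci t) (central_ricci_linear t).

(** In the contracted curvature the terms with <z, v> <J^2 u, v> and <z, v> J^2 v
    give <J^2 u, z> = 0 and J^2 z = 0.  The term with <J u, v> J v gives
    3/4 <z, z> J^2 u and the one with <z, v>^2 gives - 1/4 <z, z> J^2 u, which
    add up to 1/2; the term with <J^2 v, v> gives the trace. *)
Lemma ricci_centralP p (w : p.+1.-tuple V) (T : 'End(V)) :
  orthonormal_basis b w ->
  ricci_operator br b T <->
  T =1 central_ricci (metric_trace b w (J \o J)%VF).
Proof.
move=> w_on.
have contr m (v : m.+1.-tuple V) u : orthonormal_basis b v ->
    \sum_(k < m.+1) b (tnth v k) (tnth v k) *:
      curvature br central_connection (tnth v k) u (tnth v k) =
    central_ricci (metric_trace b w (J \o J)%VF) u.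
  move=> v_on; rewrite /central_ricci; pose eps k := b (tnth v k) (tnth v k).
  (* The five terms of the curvature, summed separately. *)
  transitivity (
    (3 / 4 * b z z) *: (\sum_k (eps k * b (J u) (tnth v k)) *: J (tnth v k))
    + (4^-1 * \sum_k eps k * (b z (tnth v k) * b (J (J u)) (tnth v k))) *: z
    - (4^-1 * \sum_k eps k * (b z (tnth v k) * b z (tnth v k))) *: J (J u)
    - (4^-1 * b z u * metric_trace b v (J \o J)%VF) *: z
    + (4^-1 * b z u) *:
        \sum_k (eps k * b z (tnth v k)) *: (J \o J)%VF (tnth v k)).
    rewrite /metric_trace !mulr_sumr !scaler_suml !scaler_sumr.
    rewrite -big_split -!sumrB -big_split /=; apply: eq_bigr => k _.
    rewrite curvature_central -/(eps k) !comp_lfunE.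
    by apply: coord_ext => i; rewrite !(linearD, linearN, linearZ) /=; field.
  rewrite (orthonormal_contraction v_on J).
  rewrite (orthonormal_contraction v_on (J \o J)%VF).
  rewrite !(orthonormal_parseval v_on) /= comp_lfunE Jz linear0 scaler0 addr0.
  rewrite [b z (J _)]form_sym J_skew Jz linear0r oppr0 mulr0 scale0r addr0.
  rewrite (metric_trace_indep _ v_on w_on).
  by apply: coord_ext => i; rewrite !(linearD, linearN, linearZ) /=; field.
split=> [[N [N_lc [m [v [v_on TE]]]]] u|TE].
  rewrite TE -(contr _ _ _ v_on); apply: eq_bigr => k _; congr (_ *: _).
  have N_eq : N =2 central_connection.
    by apply: (levi_civita_unique _ N_lc levi_civita_central); exists m, v.
  by rewrite /curvature !N_eq.
exists central_connection; split; first exact: levi_civita_central.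
by exists p, w; split=> // u; rewrite TE (contr _ _ _ w_on).
Qed.

End CentralBracket.

(** * Heisenberg algebras with a diagonal metric *)

Section DiagForm.
Variables (R : realType) (m : nat) (d : seq R).
Local Notation V := 'rV[R]_m.
Local Notation b := (diag_form m d).

Lemma diag_form_delta_r (u : V) k : b u (delta_mx 0 k) = d`_k * u 0 k.
Proof.
rewrite /= /diag_form_fun (bigD1 k) //= big1 => [|j ne_jk].
  by rewrite !mxE !eqxx mulr1 addr0.
by rewrite !mxE (negPf ne_jk) mulr0.
Qed.

Lemma diag_form_scale_delta_l c k (w : V) :
  b (c *: delta_mx 0 k) w = c * (d`_k * w 0 k).
Proof. by rewrite -diag_form_delta_r [b w _]form_sym linearZl. Qed.

(** Otherwise the k-th canonical vector would be orthogonal to all vectors. *)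
Lemma lorentzian_diag_neq0 (k : 'I_m) : lorentzian b -> d`_k != 0.
Proof.
move=> [p [v v_on]]; apply/eqP => dk0.
have /(orthonormal_nondegenerate v_on)/matrixP/(_ 0 k)/eqP :
    forall w, b (delta_mx 0 k) w = b 0 w.
  by move=> w; rewrite form_sym diag_form_delta_r dk0 mul0r linear0l.
by rewrite !mxE !eqxx oner_eq0.
Qed.

End DiagForm.

Section DiagHeisenberg.
Variables (R : realType) (n : nat) (d : seq R).
Local Notation V := 'rV[R]_(n.*2.+1).
Local Notation h := (heisenberg R n).
Local Notation b := (diag_form n.*2.+1 d).
Local Notation f := (heis_f R n).
Local Notation g := (heis_g R n).
Local Notation z := (heis_z R n).

Lemma heisE (u v : V) : h u v = h u v 0 ord_max *: z.
Proof. by rewrite /= /heis_bracket_fun !mxE !eqxx mulr1. Qed.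

Lemma heis_z_delta : z 0 ord_max = 1.
Proof. by rewrite !mxE !eqxx. Qed.

(** The operator J with [u, v] = <J u, v> z: its matrix in the canonical basis is
    that of the bracket, with the k-th column divided by the k-th diagonal
    coefficient of the metric. *)
Definition heis_J : 'End(V) :=
  linfun (mulmxr (\matrix_(i < n.*2.+1, k < n.*2.+1)
    ((d`_k)^-1 * h (delta_mx 0 i) (delta_mx 0 k) 0 ord_max))).

Hypothesis b_lor : lorentzian b.

Lemma heis_JP (u v : V) : b (heis_J u) v = h u v 0 ord_max.
Proof.
have JE k : heis_J u 0 k =
    \sum_i u 0 i * ((d`_k)^-1 * h (delta_mx 0 i) (delta_mx 0 k) 0 ord_max).
  by rewrite /heis_J lfunE /= mxE; apply: eq_bigr => i _; rewrite [in LHS]mxE.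
rewrite [in RHS](row_sum_delta u) linear_sumlz summxE.
transitivity (\sum_k \sum_i u 0 i *
    (h (delta_mx 0 i) (delta_mx 0 k) 0 ord_max * v 0 k)).
  apply: eq_bigr => k _; rewrite JE mulr_sumr mulr_suml; apply: eq_bigr => i _.
  by field; exact: lorentzian_diag_neq0 _ b_lor.
rewrite exchange_big; apply: eq_bigr => i _ /=; rewrite linearZl /= mxE.
rewrite -mulr_sumr [in RHS](row_sum_delta v) linear_sumr summxE; congr (_ * _).
by apply: eq_bigr => k _; rewrite linearZ /= mulrC [in RHS]mxE.
Qed.

Lemma heis_brE (u v : V) : h u v = b (heis_J u) v *: z.
Proof. by rewrite heis_JP -heisE. Qed.

Lemma heis_J_skew (u v : V) : b (heis_J u) v = - b u (heis_J v).
Proof. by rewrite [b u _]form_sym !heis_JP lie_anticomm mxE. Qed.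

Lemma heis_Jz : heis_J z = 0.
Proof.
have [m [v v_on]] := b_lor; apply: (orthonormal_nondegenerate v_on) => w.
by rewrite heis_JP lie_anticomm [h w z]heis_z_central linear0l oppr0 mxE.
Qed.

Lemma heis_f_coord i j : (i < n)%N -> (j < n)%N ->
  f i 0 (inord j.*2) = (i == j)%:R /\ f i 0 (inord j.*2.+1) = 0.
Proof.
move=> lt_i lt_j; rewrite !mxE /= -!val_eqE /= !inordK
  ?ltnS ?ltn_double ?leq_double ?(ltnW lt_i) ?(ltnW lt_j) //.
rewrite (inj_eq double_inj) eq_sym; split=> //.
by case: eqP => // /(congr1 odd); rewrite /= !odd_double.
Qed.

Lemma heis_g_coord i j : (i < n)%N -> (j < n)%N ->
  g i 0 (inord j.*2.+1) = (i == j)%:R /\ g i 0 (inord j.*2) = 0.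
Proof.
move=> lt_i lt_j; rewrite !mxE /= -!val_eqE /= !inordK
  ?ltnS ?ltn_double ?leq_double ?(ltnW lt_i) ?(ltnW lt_j) //.
rewrite eqSS (inj_eq double_inj) eq_sym; split=> //.
by case: eqP => // /(congr1 odd); rewrite /= !odd_double.
Qed.

Lemma heis_bracket_f i (w : V) : (i < n)%N ->
  h (f i) w = w 0 (inord i.*2.+1) *: z.
Proof.
move=> lt_i; congr (_ *: _).
rewrite (bigD1 (Ordinal lt_i)) //= big1 => [|k ne_ki].
  have [-> ->] := heis_f_coord lt_i lt_i.
  by rewrite eqxx mul0r ?sub0r ?subr0 addr0 mul1r.
have [-> ->] := heis_f_coord lt_i (ltn_ord k).
by rewrite eq_sym -val_eqE /= in ne_ki; rewrite (negPf ne_ki) !mul0r subr0.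
Qed.

Lemma heis_bracket_g i (w : V) : (i < n)%N ->
  h (g i) w = - w 0 (inord i.*2) *: z.
Proof.
move=> lt_i; congr (_ *: _).
rewrite (bigD1 (Ordinal lt_i)) //= big1 => [|k ne_ki].
  have [-> ->] := heis_g_coord lt_i lt_i.
  by rewrite eqxx mul0r ?sub0r ?subr0 addr0 mul1r.
have [-> ->] := heis_g_coord lt_i (ltn_ord k).
by rewrite eq_sym -val_eqE /= in ne_ki; rewrite (negPf ne_ki) !mul0r subr0.
Qed.

Lemma heis_J_f i : (i < n)%N -> heis_J (f i) = (d`_i.*2.+1)^-1 *: g i.
Proof.
move=> lt_i; have [m [v v_on]] := b_lor.
apply: (orthonormal_nondegenerate v_on) => w.
rewrite heis_JP heis_bracket_f // mxE heis_z_delta mulr1 diag_form_scale_delta_l.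
rewrite inordK ?ltnS ?ltn_double //.
have := lorentzian_diag_neq0 (inord i.*2.+1) b_lor.
by rewrite inordK ?ltnS ?ltn_double // => d_neq0; field.
Qed.

Lemma heis_J_g i : (i < n)%N -> heis_J (g i) = - (d`_i.*2)^-1 *: f i.
Proof.
move=> lt_i; have [m [v v_on]] := b_lor.
apply: (orthonormal_nondegenerate v_on) => w.
rewrite heis_JP heis_bracket_g // mxE heis_z_delta mulr1 diag_form_scale_delta_l.
rewrite inordK ?ltnS ?leq_double 1?ltnW //.
have := lorentzian_diag_neq0 (inord i.*2) b_lor.
by rewrite inordK ?ltnS ?leq_double 1?ltnW // => d_neq0; field.
Qed.

Lemma heis_J2_f i : (i < n)%N ->
  heis_J (heis_J (f i)) = - (d`_i.*2 * d`_i.*2.+1)^-1 *: f i.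
Proof.
move=> lt_i; rewrite heis_J_f // linearZ /= heis_J_g // scalerA invfM.
by congr (_ *: _); ring.
Qed.

Lemma heis_J2_g i : (i < n)%N ->
  heis_J (heis_J (g i)) = - (d`_i.*2 * d`_i.*2.+1)^-1 *: g i.
Proof.
move=> lt_i; rewrite heis_J_g // linearZ /= heis_J_f // scalerA invfM.
by congr (_ *: _); ring.
Qed.

Lemma heis_z_f i : (i < n)%N -> b z (f i) = 0.
Proof.
move=> lt_i.
rewrite diag_form_delta -val_eqE /= inordK ?ltnS ?leq_double 1?ltnW //.
by rewrite gtn_eqF // ltn_double.
Qed.

Lemma heis_z_g i : (i < n)%N -> b z (g i) = 0.
Proof.
move=> lt_i; rewrite diag_form_delta -val_eqE /= inordK ?ltnS ?ltn_double //.
by rewrite gtn_eqF // -doubleS leq_double.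
Qed.

Lemma heis_zz : b z z = d`_n.*2.
Proof. by rewrite diag_form_delta eqxx. Qed.

(** The scalar by which Ric acts on the plane of f_i and g_i is the same for all
    i, because the derivation Ric - eta maps [f_i, g_i] = z to a multiple of z
    that does not depend on i. *)
Lemma heis_soliton_pairs i j : algebraic_ricci_soliton h b ->
  (i < n)%N -> (j < n)%N ->
  d`_i.*2 * d`_i.*2.+1 = d`_j.*2 * d`_j.*2.+1.
Proof.
move=> [_ [T [T_ric [eta [D [D_der TE]]]]]] lt_i lt_j.
have [m [v v_on]] := b_lor.
have /(ricci_centralP heis_brE heis_Jz heis_J_skew _ v_on) TE' := T_ric.
set t := metric_trace _ _ _ in TE'.
have DE u : D u = T u - eta *: u.
  by rewrite TE add_lfunE scale_lfunE id_lfunE addrC addKr.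
(* The eigenvalue of Ric on the plane of f_k and g_k. *)
pose p k := - (d`_n.*2 / 2 / (d`_k.*2 * d`_k.*2.+1)).
have Df k : (k < n)%N -> D (f k) = (p k - eta) *: f k.
  move=> lt_k; rewrite DE TE' /central_ricci heis_J2_f // heis_z_f //.
  rewrite heis_zz mulr0 scale0r subr0.
  by rewrite scalerA mulrN scalerBl.
have Dg k : (k < n)%N -> D (g k) = (p k - eta) *: g k.
  move=> lt_k; rewrite DE TE' /central_ricci heis_J2_g // heis_z_g //.
  rewrite heis_zz mulr0 scale0r subr0.
  by rewrite scalerA mulrN scalerBl.
(* The eigenvalue of Ric - eta on z. *)
pose c := - (t / 4 * d`_n.*2) - eta.
have Dz : D z = c *: z.
  rewrite DE TE' /central_ricci heis_Jz linear0 scaler0 sub0r heis_zz.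
  by rewrite -scaleNr -scalerBl.
have pE k : (k < n)%N -> 2 * (p k - eta) = c.
  move=> lt_k; have := D_der (f k) (g k).
  have fg : h (f k) (g k) = z by rewrite heisenberg_fg // eqxx scale1r.
  rewrite Df // Dg // linearZl linearZ /= ![heis_bracket_fun _ _]fg Dz.
  rewrite -scalerDl => /matrixP/(_ 0 ord_max); rewrite [in LHS]mxE [in RHS]mxE.
  by rewrite heis_z_delta !mulr1 => <-; ring.
have dn_neq0 : d`_n.*2 != 0 := lorentzian_diag_neq0 ord_max b_lor.
have : p i = p j.
  have := pE j lt_j; rewrite -(pE i lt_i) => /(mulfI _); rewrite pnatr_eq0.
  by move=> /(_ isT)/addIr.
move=> /oppr_inj/(mulfI _)-/(_ _)/invr_inj; apply.
by rewrite mulf_neq0 // invr_eq0 pnatr_eq0.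
Qed.

End DiagHeisenberg.

(** * The three-dimensional case *)

Section Heisenberg3.
Variables (R : realType) (lambda : R).
Hypothesis lambda_gt0 : 0 < lambda.
Local Notation h := (heisenberg R 1).
Local Notation b := (diag_form 3 [:: 1; -1; lambda]).
Local Notation f := (heis_f R 1 0).
Local Notation g := (heis_g R 1 0).
Local Notation z := (heis_z R 1).
Local Notation s := (Num.sqrt lambda).
Local Notation v := [tuple f; s^-1 *: z; g].
Local Notation D := (diag_operator v [tuple - lambda; - 2 * lambda; - lambda]).
Local Notation Ric :=
  (diag_operator v [tuple lambda / 2; - lambda / 2; lambda / 2]).

Lemma sqrt_lambda_neq0 : s != 0.
Proof. by rewrite gt_eqF // sqrtr_gt0. Qed.

Lemma heis3_orthonormal : orthonormal_basis b v.
Proof.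
have ff : b f f = 1 by rewrite diag_form_delta eqxx inordK.
have gg : b g g = -1 by rewrite diag_form_delta eqxx inordK.
have zz : b z z = lambda by rewrite diag_form_delta eqxx.
have fg : b f g = 0 by rewrite diag_form_delta -val_eqE /= !inordK.
have zf : b z f = 0 by exact: (@heis_z_f R 1).
have zg : b z g = 0 by exact: (@heis_z_g R 1).
apply: orthonormal_basis_of_gram; first by rewrite dimvf /dim /= mul1n.
have zr w : b w (s^-1 *: z) = s^-1 * b z w by rewrite linearZ form_sym.
have zl w : b (s^-1 *: z) w = s^-1 * b z w by rewrite linearZl.
have sK : s^-1 * (s^-1 * lambda) = 1.
  by rewrite mulrA -invfM -expr2 sqr_sqrtr ?ltW // mulVf // gt_eqF.
move=> [[|[|[|//]]] ?] [[|[|[|//]]] ?]; rewrite !(tnth_nth 0) -!val_eqE.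
- exact: ff.
- by apply: (etrans (zr f)); rewrite zf mulr0.
- exact: fg.
- by apply: (etrans (zl f)); rewrite zf mulr0.
- by apply: (etrans (zl _)); rewrite zr zz.
- by apply: (etrans (zl g)); rewrite zg mulr0.
- by apply: (etrans (form_sym _ g f)).
- by apply: (etrans (zr g)); rewrite zg mulr0.
- exact: gg.
Qed.

Let v_on := heis3_orthonormal.
Let v_free : free v.
Proof. by have [/andP[_ ]] := v_on. Qed.

Lemma heis3_ricci (T : 'End('rV[R]_3)) : ricci_operator h b T <-> T = Ric.
Proof.
have b_lor : lorentzian b by exists 2, v; exact: v_on.
rewrite (ricci_centralP (@heis_brE R 1 _ b_lor) (@heis_Jz R 1 _ b_lor)
  (@heis_J_skew R 1 _ b_lor) _ v_on).
set J := heis_J _ _; set t := metric_trace _ _ _.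
have Jf : J (J f) = f.
  by rewrite (@heis_J2_f R 1 _ b_lor) //= mul1r invrN1 opprK scale1r.
have Jg : J (J g) = g.
  by rewrite (@heis_J2_g R 1 _ b_lor) //= mul1r invrN1 opprK scale1r.
have Jz : J z = 0 := @heis_Jz R 1 _ b_lor.
have zf : b z f = 0 by exact: (@heis_z_f R 1).
have zg : b z g = 0 by exact: (@heis_z_g R 1).
have zz : b z z = lambda by exact: (@heis_zz R 1).
have zv : b z (s^-1 *: z) = s^-1 * lambda.
  by rewrite linearZ /= [diag_form_fun _ _ _]zz.
have JJv k : J (J (tnth v k)) = (k != 1 :> nat)%:R *: tnth v k.
  case: k => [[|[|[|//]]] ?]; rewrite !(tnth_nth 0) /= ?scale1r ?scale0r //.
  by rewrite linearZ /= Jz scaler0 linear0.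
have tE : t = 2.
  rewrite /t /metric_trace.
  rewrite (eq_bigr (fun k : 'I_3 => (k != 1 :> nat)%:R)) => [|k _].
    by rewrite !big_ord_recl big_ord0 /=; ring.
  rewrite comp_lfunE JJv linearZl /= -/(b _ _) v_on.2 eqxx /=.
  by case: ifP => _; ring.
have RicE : Ric =1 central_ricci b J z t.
  apply: (orthonormal_lfun_ext v_on) => k; rewrite (diag_operatorE _ _ v_free).
  rewrite /= /central_ricci zz tE JJv.
  case: k => [[|[|[|//]]] ?]; rewrite !(tnth_nth 0) /=.
  - by rewrite [diag_form_fun _ _ _]zf mulr0 !scale0r subr0 scale1r.
  - rewrite scale0r scaler0 sub0r [diag_form_fun _ _ _]zv -scaleNr !scalerA.
    by congr (_ *: _); field; exact: sqrt_lambda_neq0.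
  - by rewrite [diag_form_fun _ _ _]zg mulr0 !scale0r subr0 scale1r.
by split=> [TE|-> //]; apply/lfunP => u; rewrite TE RicE.
Qed.

Lemma heis3_soliton_equation : Ric = (3 * lambda / 2) *: \1%VF + D.
Proof.
apply/lfunP; apply: (orthonormal_lfun_ext v_on) => k.
rewrite /= add_lfunE scale_lfunE id_lfunE !(diag_operatorE _ _ v_free) -scalerDl.
congr (_ *: _); case: k => [[|[|[|//]]] ?]; rewrite !(tnth_nth 0) /=;
  by field.
Qed.

(** Up to a component along the central vector z, D is the scalar -lambda, so
    [D u, v] + [u, D v] = -2 lambda [u, v]; and D z = -2 lambda z. *)
Lemma heis3_derivation : derivation h D.
Proof.
have DE u : exists c, D u = - lambda *: u + c *: z.
  exists (- lambda * coord v (lift ord0 ord0) u * s^-1).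
  have [/coord_basis v_basis _] := v_on.
  rewrite {2}(v_basis _ (memvf u)) lfunE /= /diag_operator_fun.
  rewrite !big_ord_recl !big_ord0 !(tnth_nth 0) /=.
  by apply: coord_ext => i; rewrite !(linearD, linearN, linearZ) /=; ring.
have Dz : D z = (- 2 * lambda) *: z.
  apply: (scalerI (invr_neq0 sqrt_lambda_neq0)); rewrite -linearZ.
  have := @diag_operatorE _ _ _ v [tuple - lambda; - 2 * lambda; - lambda]
    (lift ord0 ord0) v_free.
  rewrite !(tnth_nth 0) /= => ->.
  by rewrite !scalerA mulrC.
move=> x y; have [c ->] := DE x; have [e ->] := DE y.
have zy : h z y = 0 by rewrite lie_anticomm [h y z]heis_z_central oppr0.
have hl : h (- lambda *: x + c *: z) y = - lambda *: h x y.
  by rewrite linearPl linearZl /= [heis_bracket_fun z y]zy scaler0 addr0.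
have hr : h x (- lambda *: y + e *: z) = - lambda *: h x y.
  by rewrite linearPr linearZr /= heis_z_central scaler0 addr0.
rewrite hl hr (heisE x y) [in RHS]linearZ /= Dz -scalerDl !scalerA.
by congr (_ *: _); ring.
Qed.

End Heisenberg3.

(** * The soliton condition for the given metric *)

Lemma size_flatten_pairs (T : Type) (s : seq T) :
  size (flatten [seq [:: x; x] | x <- s]) = (size s).*2.
Proof. by elim: s => //= x s ->; rewrite doubleS. Qed.

Theorem theorem3p10 (R : realType) (n : nat) (lambda : R)
    (sigma : n.-1.-tuple R) (n_ge1 : (1 <= n)%N) (lambda_gt0 : 0 < lambda)
    (sigma_noninc : sorted (fun x y : R => y <= x) sigma)
    (sigma_ge1 : forall s, s \in sigma -> 1 <= s) :
  let h := heisenberg R n in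
  let nu := heis_form sigma lambda in
  (algebraic_ricci_soliton h nu <-> n = 1%N) /\
  (n = 1%N ->
   let v := [tuple heis_f R n 0; (Num.sqrt lambda)^-1 *: heis_z R n;
                   heis_g R n 0] in
   let D := diag_operator v [tuple - lambda; - 2 * lambda; - lambda] in
   let Ric := diag_operator v [tuple lambda / 2; - lambda / 2; lambda / 2] in
   [/\ nu = diag_form _ [:: 1; -1; lambda],
       orthonormal_basis nu v,
       forall T : 'End('rV[R]_(n.*2.+1)), ricci_operator h nu T <-> T = Ric,
       Ric = (3 * lambda / 2) *: \1%VF + D &
       derivation h D]).
Proof.
case: n => [//|[|n]] in sigma n_ge1 sigma_noninc sigma_ge1 * => h nu.
  have nuE : nu = diag_form _ [:: 1; -1; lambda] by rewrite /nu tuple0.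
  have [[[v_on ricE] solE] derD] := (heis3_orthonormal lambda_gt0,
    heis3_ricci lambda_gt0, heis3_soliton_equation lambda_gt0,
    heis3_derivation lambda_gt0).
  rewrite nuE; split=> [|_]; last by split.
  split=> // _; split; first by do 2! eexists; exact: v_on.
  eexists; split; first by apply/ricE.
  by do 2! eexists; split; [exact: derD | exact: solE].
split=> [|//]; split=> [sol|//]; exfalso.
have nu_lor : lorentzian nu by apply: heis_form_lorentzian.
have := heis_soliton_pairs nu_lor sol (ltn0Sn _) (ltnSn n.+1).
have size_d : size (flatten [seq [:: s; s] | s <- sigma]) = n.+1.*2.
  by rewrite size_flatten_pairs size_tuple.
(* Compare the first plane with the last one, whose diagonal entries 1 and -1
   come right after the doubled sigma. *)
rewrite !nth_cat size_d ltnn [(n.+1.*2.+1 < _)%N]ltnNge leqnSn subnn subSnn /=.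
case/tupleP: sigma sigma_ge1 {sigma_noninc nu sol nu_lor size_d}
  => s sigma /= s_ge1.
have {}s_ge1 : 1 <= s by apply: s_ge1; rewrite inE eqxx.
nra.
Qed.
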